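(* Let $K$ be a field, let $a>3$ be an integer and let $H_a=\langle a,a+1,2a+3\rangle$. Then $$\mu(I_{H_a}^* )=\left\lfloor\frac{a-1}{3}\right\rfloor+3 .$$
   Context: $\langle a,a+1,2a+3\rangle$ is the subsemigroup of $\mathbb{N}$ (containing $0$) generated by the listed integers. $I_{H_a}\subset K[x,y,z]$ is the kernel of the $K$-algebra map $K[x,y,z]\to K[t]$ with $x\mapsto t^{a}$, $y\mapsto t^{a+1}$, $z\mapsto t^{2a+3}$. For a nonzero polynomial $f$, $f^*$ is its nonzero homogeneous component of least degree (standard grading), and $I_{H_a}^*=(f^*: f\in I_{H_a}, f\neq 0)$. For an ideal $J$, $\mu(J)$ is its minimal number of generators. *)

(* Defs.v *)
From HB Require Import structures.
From mathcomp Require Import all_boot all_order all_algebra.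
From mathcomp Require Import mpoly.

Set Implicit Arguments.
Unset Strict Implicit.
Unset Printing Implicit Defensive.

Import GRing.Theory.
Local Open Scope ring_scope.

Section Ideals.
Variable R : comNzRingType.

Definition ideal_gen (S : R -> Prop) (f : R) : Prop :=
  exists (k : nat) (c g : 'I_k -> R),
    (forall i, S (g i)) /\ f = \sum_(i < k) c i * g i.

Definition generates (k : nat) (g : k.-tuple R) (J : R -> Prop) : Prop :=
  forall f, J f <-> ideal_gen (fun h => h \in g) f.

(* mu(J) = m; repeated or redundant entries in the tuples are harmless, since
   only the least possible length matters. *)
Definition min_num_gens (J : R -> Prop) (m : nat) : Prop :=
  (exists g : m.-tuple R, generates g J) /\
  (forall (k : nat) (g : k.-tuple R), generates g J -> (m <= k)%N).

End Ideals.

Section InitialForms.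
Variables (n : nat) (R : nzRingType).
Implicit Type f : {mpoly R[n]}.

(* pihomog mdeg d f is the homogeneous component of f of degree d; a nonzero f
   has a nonzero component in some degree d < msize f, so the search succeeds. *)
Definition order_of f : nat :=
  find (fun d => pihomog mdeg d f != 0) (iota 0 (msize f)).

(* f^*; junk value 0 when f = 0 *)
Definition initial_form f : {mpoly R[n]} := pihomog mdeg (order_of f) f.

Lemma initial_formP f : f != 0 ->
  [/\ initial_form f != 0, initial_form f \is (order_of f).-homog
    & forall d, (d < order_of f)%N -> pihomog mdeg d f = 0].
Proof.
move=> f0; pose P d := pihomog mdeg d f != 0.
have hasP : has P (iota 0 (msize f)).
  apply: contraNT f0 => /hasPn noP.
  rewrite (pihomog_partitionE (mf := mdeg) (leqnn (msize f))) big1 // => i _.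
  by apply/eqP; rewrite -[_ == _]negbK; apply: noP; rewrite mem_iota add0n ltn_ord.
have lt_ord : (order_of f < msize f)%N.
  by move: hasP; rewrite has_find size_iota.
split; last 1 first.
- move=> d ltd; have := before_find 0%N ltd.
  by rewrite nth_iota ?(ltn_trans ltd) // add0n => /negbFE/eqP.
- by have := nth_find 0%N hasP; rewrite nth_iota.
- exact: pihomogP.
Qed.

End InitialForms.

Definition initial_ideal (n : nat) (R : comNzRingType)
    (I : {mpoly R[n]} -> Prop) : {mpoly R[n]} -> Prop :=
  ideal_gen (fun g => exists2 f, I f /\ f != 0 & g = initial_form f).

(* For positive integers w_i generating a numerical semigroup H, the defining
   ideal of K[H]: the kernel of the K-algebra map K[X_0, ..., X_(n-1)] -> K[t]
   sending X_i to t^(w i). *)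
Definition toric_map (K : fieldType) (n : nat) (w : 'I_n -> nat) :
    {mpoly K[n]} -> {poly K} :=
  mmap polyC (fun i => 'X^(w i)).

Definition defining_ideal (K : fieldType) (n : nat) (w : 'I_n -> nat)
    (f : {mpoly K[n]}) : Prop :=
  toric_map w f = 0.

(* the generators of H_a = <a, a+1, 2a+3>, matched with the variables x, y, z *)
Definition H_gens (a : nat) (i : 'I_3) : nat :=
  nth 0%N [:: a; a.+1; (2 * a + 3)%N] i.

(* Main.v *)
(** Group monomials by weight.  With [J] the ideal generated by [xz] and
    [y^(a-3m) z^m] for [0 <= m <= ceil(a/3)], a monomial outside [J] has strictly
    larger degree than every other monomial of its weight.  The coefficients of
    an element of [I] cancel within each weight, so such a monomial cannot occur
    in an initial form.  Conversely, the generators of [J] are the initial forms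
    of [xz - y^3] and of [y^(a-3m) z^m - x^(a+1-m) y^(3m-a)].  They form an
    antichain, so taking the coefficients at them maps [J] onto [K^N] and kills
    [(x,y,z) J]; hence none of them can be spared. *)
Require Import Defs.
From mathcomp Require Import all_boot all_order all_algebra.
From mathcomp Require Import mpoly zify.

Set Implicit Arguments.
Unset Strict Implicit.
Unset Printing Implicit Defensive.

Import GRing.Theory.
Local Open Scope ring_scope.

(** * Ideals described by generators *)

Section IdealGen.
Variable R : comNzRingType.
Implicit Types (S J : R -> Prop) (f : R).

Lemma ideal_gen_mem S f : S f -> ideal_gen S f.
Proof.
by move=> Sf; exists 1%N, (fun=> 1), (fun=> f); rewrite big_ord1 mul1r.
Qed.

Lemma ideal_gen0 S : ideal_gen S 0.
Proof.
exists 0%N, (fun=> 0), (fun=> 0).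
by split=> [[]//|]; rewrite big_ord0.
Qed.

Lemma ideal_genD S f g : ideal_gen S f -> ideal_gen S g -> ideal_gen S (f + g).
Proof.
move=> [k [c [u [Su ->]]]] [l [d [v [Sv ->]]]].
pose glue (F : 'I_k -> R) (G : 'I_l -> R) i :=
  match split i with inl i1 => F i1 | inr i2 => G i2 end.
exists (k + l)%N, (glue c d), (glue u v).
split=> [i|]; first by rewrite /glue; case: split.
rewrite big_split_ord; congr (_ + _); apply: eq_bigr => i _; rewrite /glue.
  by rewrite (unsplitK (inl i)).
by rewrite (unsplitK (inr i)).
Qed.

Lemma ideal_genMl S r f : ideal_gen S f -> ideal_gen S (r * f).
Proof.
move=> [k [c [u [Su ->]]]]; exists k, (fun i => r * c i), u; split=> //.
by rewrite mulr_sumr; apply: eq_bigr => i _; rewrite mulrA.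
Qed.

Lemma ideal_gen_sum S (I : eqType) (r : seq I) (F : I -> R) :
  (forall i, i \in r -> ideal_gen S (F i)) -> ideal_gen S (\sum_(i <- r) F i).
Proof.
elim: r => [|i r IHr] SF; first by rewrite big_nil; apply: ideal_gen0.
rewrite big_cons; apply: ideal_genD; first by apply: SF; rewrite mem_head.
by apply: IHr => j rj; apply: SF; rewrite inE rj orbT.
Qed.

Lemma ideal_gen_min S J :
    J 0 -> (forall f g, J f -> J g -> J (f + g)) ->
    (forall r f, J f -> J (r * f)) -> (forall f, S f -> J f) ->
  forall f, ideal_gen S f -> J f.
Proof.
move=> J0 JD JM SJ _ [k [c [u [Su ->]]]].
by apply: big_ind => // i _; apply/JM/SJ.
Qed.

Lemma eq_min_num_gens J J' m :
  (forall f, J f <-> J' f) -> min_num_gens J m -> min_num_gens J' m.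
Proof.
move=> eqJ [[g Jg] minJ]; split=> [|k h J'h].
  by exists g => f; rewrite -eqJ.
by apply: (minJ k h) => f; rewrite eqJ.
Qed.

End IdealGen.

(** * Monomial ideals and their minimal number of generators *)

Section MonomialIdeal.
Variables (K : fieldType) (n : nat) (s : seq 'X_{1..n}).
Implicit Types (f g : {mpoly K[n]}) (m : 'X_{1..n}).

Definition in_monomials m := has (fun u => u <= m)%MM s.

(** Encoded through the support, so that membership is decided one monomial at a time. *)
Definition monomial_ideal f := {in msupp f, forall m, in_monomials m}.

Lemma in_monomialsD m m' : in_monomials m -> in_monomials (m' + m)%MM.
Proof.
move=> /hasP[u su le_um]; apply/hasP; exists u => //.
by apply: lepm_trans le_um _; apply: lem_addl.
Qed.

Lemma monomial_idealX m : in_monomials m -> monomial_ideal 'X_[m].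
Proof. by move=> sm m'; rewrite msuppX inE => /eqP->. Qed.

Lemma monomial_idealD f g :
  monomial_ideal f -> monomial_ideal g -> monomial_ideal (f + g).
Proof. by move=> Jf Jg m /msuppD_le; rewrite mem_cat => /orP[/Jf|/Jg]. Qed.

Lemma monomial_idealMl f g : monomial_ideal g -> monomial_ideal (f * g).
Proof.
by move=> Jg _ /msuppM_le/allpairsP[[u v] [_ /= /Jg sv ->]]; apply: in_monomialsD.
Qed.

Lemma monomial_ideal_gen f :
  monomial_ideal f <-> ideal_gen (fun h => h \in [seq 'X_[m] | m <- s]) f.
Proof.
split=> [Jf|].
  rewrite [f]mpolyE; apply: ideal_gen_sum => m /Jf/hasP[u su /submK<-].
  rewrite mpolyXD -mul_mpolyC mulrA; apply/ideal_genMl/ideal_gen_mem.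
  exact: map_f.
apply: ideal_gen_min => [m||r g|g /mapP[m sm ->]].
- by rewrite msupp0.
- exact: monomial_idealD.
- exact: monomial_idealMl.
- by apply/monomial_idealX/hasP; exists m => //; apply: lepm_refl.
Qed.

Hypothesis s_uniq : uniq s.
Hypothesis s_antichain : {in s &, forall u v, (u <= v)%MM -> u = v}.

(* A monomial of an element of the ideal that divides a minimal generator is
   that generator, so only the constant term of [f] matters. *)
Lemma mcoeffM_min_gen f g m :
  monomial_ideal g -> m \in s -> (f * g)@_m = f@_0%MM * g@_m.
Proof.
move=> Jg sm; have [d leD] := ubnP (mdeg m).
rewrite [f in LHS]mpolyE [g in LHS]mpolyE big_distrl raddf_sum /=.
transitivity (\sum_(u <- msupp f) f@_u * (u == 0%MM)%:R * g@_m).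
  apply: eq_bigr => u _; rewrite big_distrr raddf_sum /=.
  transitivity (\sum_(v <- msupp g) f@_u * (u == 0%MM)%:R * (g@_v * (v == m)%:R)).
    rewrite !big_seq; apply: eq_bigr => v gv.
    rewrite -scalerAl -scalerAr -mpolyXD !mcoeffZ mcoeffX.
    suff -> : ((u + v)%MM == m) = (u == 0%MM) && (v == m).
      by case: eqP; rewrite ?mulr0 ?mul0r ?mulr1.
    apply/eqP/andP => [def_m|[/eqP-> /eqP->]]; last by rewrite add0m.
    have /hasP[w sw le_wv] := Jg v gv.
    have le_vm : (v <= m)%MM by rewrite -def_m lem_addl.
    have wm : w = m by apply: s_antichain => //; apply: lepm_trans le_wv le_vm.
    have vm : v = m.
      apply/mnmP => i; apply/eqP; rewrite eqn_leq (mnm_lepP le_vm) -wm.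
      exact: (mnm_lepP le_wv).
    by split; [rewrite -(eqm_add2r v) def_m add0m vm | rewrite vm].
  rewrite -big_distrr /=; congr (_ * _).
  rewrite [in RHS](mpolyE g) raddf_sum; apply: eq_bigr => v _ /=.
  by rewrite mcoeffZ mcoeffX.
rewrite -big_distrl; congr (_ * _).
rewrite [in RHS](mpolyE f) raddf_sum; apply: eq_bigr => v _ /=.
by rewrite mcoeffZ mcoeffX.
Qed.

Lemma min_num_gens_monomial : min_num_gens monomial_ideal (size s).
Proof.
split=> [|k g genJ].
  by exists (map_tuple (fun m => 'X_[m]) (in_tuple s)); apply: monomial_ideal_gen.
pose coefs f := \row_(j < size s) f@_(nth 0%MM s j).
pose A := \matrix_(i < k) coefs (tnth g i).
have Jg h : h \in g -> monomial_ideal h.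
  by move=> gh; apply/genJ/ideal_gen_mem.
(* The coefficient vectors of any generating tuple span the whole space, so the rank of [A], at most
   [k], is at least [size s]. *)
have fullA : (1%:M <= A)%MS.
  apply/row_subP => i.
  have sm : nth 0%MM s i \in s by rewrite mem_nth.
  have /genJ[l [c [h [gh defX]]]] : monomial_ideal 'X_[nth 0%MM s i].
    by apply/monomial_idealX/hasP; exists (nth 0%MM s i); rewrite ?lepm_refl.
  (* The unit row is the coefficient vector of a minimal generator; when this one is expanded over
     [g], only the constant terms of the multipliers survive. *)
  have -> : row i 1%:M = \sum_(t < l) (c t)@_0%MM *: coefs (h t).
    apply/rowP => j; rewrite summxE rowE mulmx1 mxE eqxx /=.
    have -> : (j == i)%:R = ('X_[nth 0%MM s i] : {mpoly K[n]})@_(nth 0%MM s j).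
      by rewrite mcoeffX nth_uniq // eq_sym.
    rewrite defX raddf_sum; apply: eq_bigr => t _.
    by rewrite !mxE; apply: mcoeffM_min_gen; [apply: Jg | rewrite mem_nth].
  apply: summx_sub => t _; apply: scalemx_sub.
  have /tnthP[j ->] := gh t.
  by rewrite (_ : coefs _ = row j A) ?row_sub // rowK.
by have := mxrankS fullA; rewrite mxrank1 => /leq_trans-> //; apply: rank_leq_row.
Qed.

End MonomialIdeal.

(** * Homogeneous components and initial forms *)

Section InitialForm.
Variables (n : nat) (K : fieldType).
Implicit Types (f : {mpoly K[n]}) (m : 'X_{1..n}).

Lemma mcoeff_pihomog d f m :
  (pihomog mdeg d f)@_m = if mdeg m == d then f@_m else 0.
Proof.
rewrite pihomogE raddf_sum [in RHS](mpolyE f) raddf_sum /=.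
case: eqP => [<-|neq_md]; last first.
  rewrite big1 // => u /eqP deg_u; rewrite mcoeffZ mcoeffX.
  by case: eqP => [um|_]; [case: neq_md; rewrite -um | rewrite mulr0].
rewrite big_mkcond; apply: eq_bigr => u _; rewrite mcoeffZ mcoeffX.
by case: (u =P m) => [->|_]; rewrite ?eqxx // mulr0 if_same.
Qed.

Lemma msupp_initial_form f m : m \in msupp (initial_form f) ->
  m \in msupp f /\ {in msupp f, forall m', mdeg m <= mdeg m'}%N.
Proof.
have [->|f0] := eqVneq f 0.
  by rewrite /initial_form pihomog0 msupp0.
have [_ _ lt0] := initial_formP f0.
rewrite mcoeff_msupp mcoeff_pihomog; case: (mdeg m =P _) => [->|]; last by rewrite eqxx.
move=> fm; split=> [|m' fm']; first by rewrite mcoeff_msupp.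
rewrite leqNgt; apply: contraL fm' => /lt0/(congr1 (mcoeff m')).
by rewrite mcoeff_pihomog eqxx mcoeff0 mcoeff_msupp => ->; rewrite eqxx.
Qed.

Lemma initial_form_binomial m m' : (mdeg m < mdeg m')%N ->
  'X_[m] - 'X_[m'] != 0 :> {mpoly K[n]} /\
  initial_form ('X_[m] - 'X_[m']) = 'X_[m] :> {mpoly K[n]}.
Proof.
move=> lt_deg; set f := _ - _.
have pif d : pihomog mdeg d f =
    (if mdeg m == d then 'X_[m] else 0) - (if mdeg m' == d then 'X_[m'] else 0).
  by rewrite pihomogB !pihomogX.
have Xn0 u : 'X_[u] != 0 :> {mpoly K[n]}.
  by rewrite -msupp_eq0 msuppX.
have pim : pihomog mdeg (mdeg m) f = 'X_[m].
  by rewrite pif eqxx gtn_eqF // subr0.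
have f0 : f != 0 by apply: contraNneq (Xn0 m) => f0; rewrite -pim f0 pihomog0.
split=> //; have [n0 _ lt0] := initial_formP f0.
rewrite -pim /initial_form; congr (pihomog _ _ _).
(* The order cannot exceed [mdeg m], where the component is nonzero, nor fall below it, where all
   components vanish. *)
apply/eqP; rewrite eqn_leq leqNgt; apply/andP; split.
  by apply: contra (Xn0 m) => /lt0; rewrite pim => ->.
rewrite leqNgt; apply: contra n0 => lt_ord.
by rewrite /initial_form pif !gtn_eqF ?subr0 // (ltn_trans lt_ord).
Qed.

End InitialForm.

(** * Weights and the kernel of the toric map *)

Section ToricIdeal.
Variables (K : fieldType) (n : nat) (w : 'I_n -> nat).
Implicit Types (f : {mpoly K[n]}) (m : 'X_{1..n}).

Definition mweight m := (\sum_(i < n) w i * m i)%N.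

Lemma toric_mapE f :
  toric_map w f = \sum_(m <- msupp f) f@_m *: 'X^(mweight m).
Proof.
apply: eq_bigr => m _; rewrite mul_polyC; congr (_ *: _).
by rewrite /mmap1 -prodrXr; apply: eq_bigr => i _; rewrite exprM.
Qed.

Lemma defining_ideal_binomial m m' : mweight m = mweight m' ->
  defining_ideal w ('X_[m] - 'X_[m'] : {mpoly K[n]}).
Proof.
move=> eq_w; have mapX u : toric_map w ('X_[u] : {mpoly K[n]}) = 'X^(mweight u).
  by rewrite toric_mapE msuppX big_seq1 mcoeffX eqxx scale1r.
by rewrite /defining_ideal /toric_map mmapB -!/(toric_map w _) !mapX eq_w subrr.
Qed.

(** The coefficient of the image at [mweight m] sums the coefficients of [f] over that weight; if
    [m] were alone there, it would be [f@_m], which is nonzero. *)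
Lemma defining_ideal_same_weight f m : defining_ideal w f -> m \in msupp f ->
  exists m', [/\ m' \in msupp f, m' != m & mweight m' = mweight m].
Proof.
move=> If fm.
have [/hasP[m' fm' /andP[]]|/hasPn alone] :=
    boolP (has (fun u => (u != m) && (mweight u == mweight m)) (msupp f)).
  by move=> ? /eqP; exists m'.
have := congr1 (fun p : {poly K} => p`_(mweight m)) If.
rewrite /= toric_mapE coef_sum coef0 (bigD1_seq m) //= coefZ coefXn eqxx mulr1.
rewrite big_seq_cond big1 ?addr0 => [/eqP|u /andP[fu neq_um]].
  by rewrite mcoeff_eq0 fm.
have := alone u fu; rewrite neq_um coefZ coefXn (eq_sym (mweight m)) /=.
by move=> /negbTE->; rewrite mulr0.
Qed.

Lemma defining_ideal_initial_form f m :
    defining_ideal w f -> m \in msupp (initial_form f) ->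
  exists m', [/\ m' != m, mweight m' = mweight m & (mdeg m <= mdeg m')%N].
Proof.
move=> If /msupp_initial_form[fm min_m].
have [m' [fm' neq eqw]] := defining_ideal_same_weight If fm.
by exists m'; split=> //; apply: min_m.
Qed.

End ToricIdeal.

(** * Monomials in three variables *)

Definition mon3 (i j k : nat) : 'X_{1..3} :=
  [multinom nth 0%N [:: i; j; k] l | l < 3].

Lemma mon3_surj (m : 'X_{1..3}) : exists i j k, m = mon3 i j k.
Proof.
exists (m (@Ordinal 3 0 isT)), (m (@Ordinal 3 1 isT)), (m (@Ordinal 3 2 isT)).
by apply/mnmP => -[[|[|[|]]] // l3]; rewrite mnmE /=; congr (m _); apply: val_inj.
Qed.

Lemma mon3_inj i j k i' j' k' :
  mon3 i j k = mon3 i' j' k' -> [/\ i = i', j = j' & k = k'].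
Proof.
move/mnmP=> eq_m; split.
- by have := eq_m (@Ordinal 3 0 isT); rewrite !mnmE.
- by have := eq_m (@Ordinal 3 1 isT); rewrite !mnmE.
- by have := eq_m (@Ordinal 3 2 isT); rewrite !mnmE.
Qed.

Lemma lem_mon3 i j k i' j' k' :
  (mon3 i j k <= mon3 i' j' k')%MM = [&& i <= i', j <= j' & k <= k']%N.
Proof.
apply/mnm_lepP/and3P => [le_m|[? ? ?] l]; last first.
  by rewrite !mnmE; case: l => [[|[|[|]]]].
split.
- by have := le_m (@Ordinal 3 0 isT); rewrite !mnmE.
- by have := le_m (@Ordinal 3 1 isT); rewrite !mnmE.
- by have := le_m (@Ordinal 3 2 isT); rewrite !mnmE.
Qed.

Lemma mdeg_mon3 i j k : mdeg (mon3 i j k) = (i + j + k)%N.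
Proof. by rewrite mdegE !big_ord_recr big_ord0 /= !mnmE. Qed.

Lemma mweight_mon3 a i j k :
  mweight (H_gens a) (mon3 i j k) = (a * i + a.+1 * j + (2 * a + 3) * k)%N.
Proof. by rewrite /mweight !big_ord_recr big_ord0 /= !mnmE. Qed.

(** * The initial ideal for [H_gens a] *)

Section Tangent.
Variable a : nat.
Hypothesis a_gt3 : (3 < a)%N.

(* For the last index, [3 * m >= a] and the subtraction truncates: this is the
   pure power of z. *)
Definition tangent_monomials : seq 'X_{1..3} :=
  mon3 1 0 1 :: [seq mon3 0 (a - 3 * m) m | m <- iota 0 ((a - 1) %/ 3 + 2)].

(** As [(a - 1) %/ 3 + 1] is the ceiling of a/3, the indices from 0 to it number [(a - 1) %/ 3 + 2];
    xz adds one. *)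
Lemma size_tangent_monomials :
  size tangent_monomials = ((a - 1) %/ 3 + 3)%N.
Proof. by rewrite /= size_map size_iota !addnS. Qed.

Lemma tangent_monomials_uniq : uniq tangent_monomials.
Proof.
rewrite /= map_inj_uniq; last by move=> m m' /mon3_inj[].
by rewrite iota_uniq andbT; apply/mapP => -[m _ /mon3_inj[]].
Qed.

Lemma tangent_monomials_antichain :
  {in tangent_monomials &, forall u v, (u <= v)%MM -> u = v}.
Proof.
move=> u v; rewrite !inE.
move=> /orP[/eqP->|/mapP[m + ->]] /orP[/eqP->|/mapP[m' + ->]] //;
  rewrite ?mem_iota ?lem_mon3 /= => ? ? //.
(* If y^(a-3m) z^m divided xz, then m <= 1 and a <= 3m, against a > 3. *)
- by exfalso; lia.
- by move=> /andP[? ?]; suff -> : m = m' by []; lia.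
Qed.

Lemma in_tangent_monomials i j k :
  in_monomials tangent_monomials (mon3 i j k) =
  ((0 < i) && (0 < k) || (a <= j + 3 * k))%N.
Proof.
rewrite /in_monomials /= lem_mon3 leq0n /=; case: (_ && _) => //=.
apply/hasP/idP => [[_ /mapP[m _ ->]]|le_a].
  by rewrite lem_mon3; lia.
(* The largest index with z^m dividing z^k leaves the smallest power of y to be covered. *)
pose m := minn k ((a - 1) %/ 3 + 1).
exists (mon3 0 (a - 3 * m) m); last by rewrite lem_mon3 /m; lia.
by apply/mapP; exists m; rewrite // mem_iota /m; lia.
Qed.

(* Comparing weights modulo [a], where z has [y]-content 3 and counts for two
   variables, a monomial outside the ideal is the unique one of largest degree
   among those of its weight. *)
Lemma standard_mweight_max m m' :
    ~~ in_monomials tangent_monomials m ->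
    mweight (H_gens a) m' = mweight (H_gens a) m -> (mdeg m <= mdeg m')%N ->
  m' = m.
Proof.
have [i [j [k ->]]] := mon3_surj m; have [i' [j' [k' ->]]] := mon3_surj m'.
rewrite in_tangent_monomials !mweight_mon3 !mdeg_mon3 => std eq_w le_d.
have eqD : (a * (i' + j' + 2 * k') + (j' + 3 * k') =
            a * (i + j + 2 * k) + (j + 3 * k))%N by nia.
(* Outside the ideal j + 3k < a, so a larger multiple of a on the left cannot be compensated. *)
have leD : (i' + j' + 2 * k' <= i + j + 2 * k)%N by nia.
have [t defD] : exists t, (i + j + 2 * k = i' + j' + 2 * k' + t)%N.
  by exists ((i + j + 2 * k) - (i' + j' + 2 * k'))%N; lia.
have eqE : (j' + 3 * k' = j + 3 * k + a * t)%N.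
  by move: eqD; rewrite defD mulnDr; lia.
(* For t = 0, i - i' = k - k' and the degrees give k' <= k; a strict inequality would make i and k
   both positive, which is excluded. *)
have [t0|t_gt0] := posnP t; first by subst t; congr mon3; lia.
(* For t > 0, the degrees give k' + t <= k, while i - k = i' - k' + t + at; again i and k are both
   positive. *)
have : (a <= a * t)%N by rewrite leq_pmulr.
lia.
Qed.

Lemma tangent_monomial_partner m : m \in tangent_monomials ->
  exists2 m', mweight (H_gens a) m = mweight (H_gens a) m'
    & (mdeg m < mdeg m')%N.
Proof.
rewrite inE => /orP[/eqP->|/mapP[l]].
  by exists (mon3 0 3 0); rewrite ?mweight_mon3 ?mdeg_mon3 //; lia.
rewrite mem_iota => le_l ->.
exists (mon3 (a + 1 - l) (3 * l - a) 0); rewrite ?mweight_mon3 ?mdeg_mon3; last lia.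
(* At most one of the truncated exponents [a - 3 * l] and [3 * l - a] is nonzero; each case removes
   the subtractions before the weights are compared. *)
have [le_a|lt_a] := leqP (3 * l) a.
  have [r ->] : exists r, a = (3 * l + r)%N by exists (a - 3 * l)%N; lia.
  rewrite addKn (_ : 3 * l - _ = 0)%N; last lia.
  by rewrite (_ : 3 * l + r + 1 - l = 2 * l + r + 1)%N; [nia | lia].
have [r def_r] : exists r, (3 * l = a + r)%N by exists (3 * l - a)%N; lia.
rewrite def_r addKn (_ : a - _ = 0)%N; last lia.
have [u def_u] : exists u, (a + 1 = l + u)%N by exists (a + 1 - l)%N; lia.
by rewrite def_u addKn; nia.
Qed.

Lemma initial_ideal_H_gens (K : fieldType) (f : {mpoly K[3]}) :
  monomial_ideal tangent_monomials f <->
  initial_ideal (defining_ideal (K := K) (H_gens a)) f.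
Proof.
split=> [/monomial_ideal_gen|].
  apply: ideal_gen_min => [|g h|r g|_ /mapP[m /tangent_monomial_partner + ->]].
  - exact: ideal_gen0.
  - exact: ideal_genD.
  - exact: ideal_genMl.
  move=> [m' eq_w /(initial_form_binomial K)[n0 init]].
  apply: ideal_gen_mem; exists ('X_[m] - 'X_[m']) => //.
  by split=> //; apply: defining_ideal_binomial.
apply: ideal_gen_min => [m||r g|_ [g [Ig _] ->] m].
- by rewrite msupp0.
- exact: monomial_idealD.
- exact: monomial_idealMl.
move=> /(defining_ideal_initial_form Ig)[m' [neq eq_w le_d]].
(* Cancellation provides [m'] of the same weight and no smaller degree; outside the monomial ideal,
   [m] admits no such partner but itself. *)
apply: contraNT neq => std; apply/eqP.
exact: standard_mweight_max std eq_w le_d.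
Qed.

End Tangent.

Theorem mainTheorem8 (K : fieldType) (a : nat) (ha : (3 < a)%N) :
  min_num_gens (initial_ideal (defining_ideal (K := K) (H_gens a)))
               ((a - 1) %/ 3 + 3)%N.
Proof.
rewrite -size_tangent_monomials.
apply: (eq_min_num_gens (initial_ideal_H_gens ha (K := K))).
apply: min_num_gens_monomial.
  exact: tangent_monomials_uniq.
exact: tangent_monomials_antichain.
Qed.
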